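(* Let $q$ be a prime power, $n\ge2$, $E=\mathbb{F}_q^n$, and $1\le k\le n-1$. Let $\mathcal{S}_1,\mathcal{S}_2$ be disjoint collections of $k$-dimensional subspaces of $E$ such that, for $i=1,2$, $\dim(V\cap W)\le k-2$ for all distinct $V,W\in\mathcal{S}_i$. Let $\mathcal{M}_i$ be the paving $q$-matroid induced by $\mathcal{S}_i$ with characteristic polynomial $\chi_{\mathcal{M}_i}$ ($i=1,2$), let $\lambda\in\mathbb{Q}$ with $0<\lambda<1$, and let $\mathcal{M}=\lambda\mathcal{M}_1+(1-\lambda)\mathcal{M}_2$. Then $$\chi_{\mathcal{M}}(t)=\chi_{\mathcal{M}_1}(t)+(-1)^kq^{\binom{k}{2}}\Big(|\mathcal{S}_1|(t^\lambda-t)+|\mathcal{S}_2|(t^{1-\lambda}-1)\Big)$$ and $$\chi_{\mathcal{M}}(t)=\chi_{\mathcal{M}_2}(t)+(-1)^kq^{\binom{k}{2}}\Big(|\mathcal{S}_1|(t^\lambda-1)+|\mathcal{S}_2|(t^{1-\lambda}-t)\Big).$$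
   Context: $\mathcal{L}(E)$ is the lattice of subspaces of $E$. The paving $q$-matroid induced by $\mathcal{S}$ has rank function $\rho_{\mathcal{S}}(V)=k-1$ if $V\in\mathcal{S}$ and $\min\{\dim V,k\}$ otherwise. $\lambda\mathcal{M}_1+(1-\lambda)\mathcal{M}_2$ has rank function $\lambda\rho_1+(1-\lambda)\rho_2$. For a $q$-polymatroid $(\mathcal{L}(E),\rho)$ with rational values, its characteristic (Puiseux) polynomial is $\chi(t)=\sum_{X\in\mathcal{L}(E)}(-1)^{\dim X}q^{\binom{\dim X}{2}}\,t^{\rho(E)-\rho(X)}$, a finite sum of monomials with possibly rational exponents; for a $q$-matroid this is its characteristic polynomial. *)

(* Defs.v *)
From HB Require Import structures.
From mathcomp Require Import all_boot all_order all_algebra all_field.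
From mathcomp Require Import zify lra.
From mathcomp.multinomials Require Import monalg.
Set Implicit Arguments.
Unset Strict Implicit.
Unset Printing Implicit Defensive.
Import Order.TTheory GRing.Theory Num.Theory.
Local Open Scope ring_scope.

(* L(E) is {vspace 'rV[F]_n}, E being fullv; it is finite because F is. *)
HB.instance Definition _ (F : finFieldType) (vT : vectType F) :=
  Countable.copy {vspace vT} (can_type (@VectorInternalTheory.vs2mxK F vT)).
HB.instance Definition _ (F : finFieldType) (vT : vectType F) :=
  isFinite.Build {vspace vT}
    (pcan_enumP (can_pcan (@VectorInternalTheory.vs2mxK F vT))).

Record qpolymatroid (F : finFieldType) (n : nat) := QPolymatroid {
  qrank : {vspace 'rV[F]_n} -> rat;
  qrank_bound : forall V, 0 <= qrank V <= (\dim V)%:R;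
  qrank_mono : forall V W, (V <= W)%VS -> qrank V <= qrank W;
  qrank_submod : forall V W,
    qrank (V + W)%VS + qrank (V :&: W)%VS <= qrank V + qrank W
}.

Record qmatroid (F : finFieldType) (n : nat) := QMatroid {
  mrank : {vspace 'rV[F]_n} -> nat;
  mrank_bound : forall V, (mrank V <= \dim V)%N;
  mrank_mono : forall V W, (V <= W)%VS -> (mrank V <= mrank W)%N;
  mrank_submod : forall V W,
    (mrank (V + W)%VS + mrank (V :&: W)%VS <= mrank V + mrank W)%N
}.

Section QMatroidIsQPolymatroid.
Variables (F : finFieldType) (n : nat) (M : qmatroid F n).
Let r (V : {vspace 'rV[F]_n}) : rat := (mrank M V)%:R.

Fact qmatroid_bound V : 0 <= r V <= (\dim V)%:R.
Proof. by rewrite ler0n ler_nat mrank_bound. Qed.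

Fact qmatroid_mono V W : (V <= W)%VS -> r V <= r W.
Proof. by move=> sVW; rewrite ler_nat mrank_mono. Qed.

Fact qmatroid_submod V W : r (V + W)%VS + r (V :&: W)%VS <= r V + r W.
Proof. by rewrite -!natrD ler_nat mrank_submod. Qed.

Definition qmatroid_qpolymatroid : qpolymatroid F n :=
  QPolymatroid qmatroid_bound qmatroid_mono qmatroid_submod.
End QMatroidIsQPolymatroid.

Coercion qmatroid_qpolymatroid : qmatroid >-> qpolymatroid.

(* dim (V :&: W) <= k - 2 is an inequality between integers: for k = 1 it says
   that S has no two distinct elements. Hence no truncated subtraction here. *)
Definition paving_family (F : finFieldType) (n k : nat)
    (S : {set {vspace 'rV[F]_n}}) : Prop :=
  (forall V, V \in S -> \dim V = k) /\
  (forall V W, V \in S -> W \in S -> V <> W -> (\dim (V :&: W) + 2 <= k)%N).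

Definition paving_rank (F : finFieldType) (n k : nat)
    (S : {set {vspace 'rV[F]_n}}) (V : {vspace 'rV[F]_n}) : nat :=
  if V \in S then k.-1 else minn (\dim V) k.

Section Paving.
Variables (F : finFieldType) (n k : nat) (S : {set {vspace 'rV[F]_n}}).
Hypotheses (k_gt0 : (0 < k)%N) (pavS : paving_family k S).
Let r := paving_rank k S.

Fact paving_bound V : (r V <= \dim V)%N.
Proof. by rewrite /r /paving_rank; case: ifP => [/pavS.1|_]; lia. Qed.

Let dim_strict (V W : {vspace 'rV[F]_n}) :
  (V <= W)%VS -> V <> W -> (\dim V < \dim W)%N.
Proof.
move=> sVW neVW; rewrite ltnNge; apply/negP => leWV; apply: neVW.
by apply/eqP; rewrite eqEdim sVW.
Qed.

Fact paving_mono V W : (V <= W)%VS -> (r V <= r W)%N.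
Proof.
move=> sVW; have [->//|/eqP neVW] := eqVneq V W.
have ltVW := dim_strict sVW neVW.
by rewrite /r /paving_rank; case: ifP => [/pavS.1|_]; case: ifP => [/pavS.1|_];
  lia.
Qed.

Let submod_in V W : V \in S -> (r (V + W)%VS + r (V :&: W)%VS <= r V + r W)%N.
Proof.
move=> SV; have [/addv_idPr-> |nsVW] := boolP (V <= W)%VS.
  by rewrite addnC leq_add2r paving_mono ?capvSl.
have [/addv_idPl-> |nsWV] := boolP (W <= V)%VS.
  by rewrite leq_add2l paving_mono ?capvSr.
have dV := pavS.1 _ SV.
have lt1 : (\dim V < \dim (V + W))%N.
  apply: dim_strict; first exact: addvSl.
  by move=> eqV; case/negP: nsWV; rewrite eqV addvSr.
have lt2 : (\dim (V :&: W) < \dim V)%N.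
  apply: dim_strict; first exact: capvSl.
  by move=> eqV; case/negP: nsVW; rewrite -eqV capvSr.
have lt3 : (\dim (V :&: W) < \dim W)%N.
  apply: dim_strict; first exact: capvSr.
  by move=> eqV; case/negP: nsWV; rewrite -eqV capvSl.
have dVW : W \in S -> (\dim (V :&: W) + 2 <= k)%N.
  move=> SW; apply: pavS.2 => // eqVW.
  by case/negP: nsVW; rewrite eqVW.
rewrite /r /paving_rank SV.
by case: ifP => [/pavS.1|_]; case: ifP => [/pavS.1|_];
  case: ifP => [/[dup] /dVW + /pavS.1|_]; lia.
Qed.

Fact paving_submod V W :
  (r (V + W)%VS + r (V :&: W)%VS <= r V + r W)%N.
Proof.
have [SV|nSV] := boolP (V \in S); first exact: submod_in.
have [SW|nSW] := boolP (W \in S).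
  by rewrite addvC capvC [leqRHS]addnC submod_in.
have := dimv_sum_cap V W.
have := dimvS (capvSl V W); have := dimvS (capvSr V W).
rewrite /r /paving_rank (negPf nSV) (negPf nSW).
by case: ifP => [/pavS.1|_]; case: ifP => [/pavS.1|_]; lia.
Qed.

Definition paving_qmatroid : qmatroid F n :=
  QMatroid paving_bound paving_mono paving_submod.
End Paving.

Section Convex.
Variables (F : finFieldType) (n : nat) (lam : rat) (lam01 : 0 < lam < 1).
Variables (M1 M2 : qpolymatroid F n).
Let r V := lam * qrank M1 V + (1 - lam) * qrank M2 V.

Fact convex_bound V : 0 <= r V <= (\dim V)%:R.
Proof.
have /andP[l0 l1] := lam01.
by have := qrank_bound M1 V; have := qrank_bound M2 V; rewrite /r; nra.
Qed.

Fact convex_mono V W : (V <= W)%VS -> r V <= r W.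
Proof.
have /andP[l0 l1] := lam01 => sVW.
by have := qrank_mono M1 sVW; have := qrank_mono M2 sVW; rewrite /r; nra.
Qed.

Fact convex_submod V W : r (V + W)%VS + r (V :&: W)%VS <= r V + r W.
Proof.
have /andP[l0 l1] := lam01.
by have := qrank_submod M1 V W; have := qrank_submod M2 V W; rewrite /r; nra.
Qed.

Definition convex_comb : qpolymatroid F n :=
  QPolymatroid convex_bound convex_mono convex_submod.
End Convex.

(* Finitely supported formal sums of monomials t^a, a : rat, over int. *)
Definition puiseux := {malg int[rat]}.
HB.instance Definition _ := GRing.Lmodule.on puiseux.

Definition tpow (a : rat) : puiseux := mkmalgU a 1.

Definition charpoly (F : finFieldType) (n : nat) (M : qpolymatroid F n) :
    puiseux :=
  \sum_(X : {vspace 'rV[F]_n})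
     ((-1) ^+ \dim X * (#|F| ^ 'C(\dim X, 2))%:R : int)
       *: tpow (qrank M fullv - qrank M X).

(* Main.v *)
Require Import Defs.
From HB Require Import structures.
From mathcomp Require Import all_boot all_order all_algebra all_field.
From mathcomp Require Import ring.
From mathcomp.multinomials Require Import monalg.
Import Order.TTheory GRing.Theory Num.Theory.
Local Open Scope ring_scope.

(** The two rank functions of [M1] and [M2] agree outside [S1] and [S2], so the
    convex combination changes no term of the characteristic polynomial there.
    As [k < n], the whole space has rank [k] in all three q-polymatroids; hence
    on [S1] the exponents in [M], [M1], [M2] are [lam], [1], [0], and on [S2]
    they are [1 - lam], [0], [1]. *)

Section CharpolyDiff.
Variables (F : finFieldType) (n k : nat).
Implicit Types (M N : qpolymatroid F n) (X : {vspace 'rV[F]_n}).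

(** The coefficient of a term depends only on the dimension of [X], so it is the same for every [X]
    in [S1] or [S2], and the difference of the two sums is constant on each family. With the
    exponents as parameters, both formulas of the theorem are instances, [N] being [M1] or [M2]. *)
Lemma charpoly_diff M N (S1 S2 : {set {vspace 'rV[F]_n}}) (a1 b1 a2 b2 : rat) :
  [disjoint S1 & S2] ->
  (forall X, X \in S1 -> \dim X = k) -> (forall X, X \in S2 -> \dim X = k) ->
  (forall X, X \in S1 -> qrank M fullv - qrank M X = a1) ->
  (forall X, X \in S1 -> qrank N fullv - qrank N X = b1) ->
  (forall X, X \in S2 -> qrank M fullv - qrank M X = a2) ->
  (forall X, X \in S2 -> qrank N fullv - qrank N X = b2) ->
  (forall X, X \notin S1 -> X \notin S2 ->
     qrank M fullv - qrank M X = qrank N fullv - qrank N X) ->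
  charpoly M = charpoly N
    + ((-1) ^+ k * (#|F| ^ 'C(k, 2))%:R : int) *:
        ((#|S1|%:R : int) *: (tpow a1 - tpow b1)
         + (#|S2|%:R : int) *: (tpow a2 - tpow b2)).
Proof.
move=> disj dim1 dim2 M1 N1 M2 N2 MN; apply/eqP.
rewrite addrC -subr_eq -sumrB scalerDr; apply/eqP.
rewrite (bigID (mem S1)) /=; congr (_ + _).
  (* The factor [#|S1|] is unfolded into a constant sum over [S1], to be compared term by term. *)
  rewrite scaler_nat -scalerMnr -sumr_const.
  by apply: eq_bigr => X S1X; rewrite dim1 // M1 // N1 // -scalerBr.
rewrite (bigID (mem S2)) /= [X in _ + X]big1 ?addr0 => [|X /andP[nS1X nS2X]];
  last by rewrite MN // subrr.
rewrite scaler_nat -scalerMnr -sumr_const.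
apply: eq_big => [X|X /andP[_ S2X]]; last by rewrite dim2 // M2 // N2 // -scalerBr.
(* By disjointness, the elements of [S2] outside [S1] are all of [S2]. *)
by case S2X: (X \in S2); rewrite ?andbF // (disjointFl disj S2X).
Qed.

Variables (S : {set {vspace 'rV[F]_n}}) (k_gt0 : (0 < k)%N).
Hypotheses (k_ltn : (k < n)%N) (pavS : paving_family k S).
Let M : qpolymatroid F n := paving_qmatroid k_gt0 pavS.

Lemma paving_qrank_full : qrank M fullv = k%:R.
Proof.
have dimE : \dim (fullv : {vspace 'rV[F]_n}) = n by rewrite dimvf /dim /= mul1n.
rewrite /= /paving_rank dimE (minn_idPr (ltnW k_ltn)).
(* Were the whole space in [S], its dimension [n] would equal [k]. *)
by case: ifP => // /pavS.1 eq_nk; move: k_ltn; rewrite -eq_nk dimE ltnn.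
Qed.

Lemma paving_qrank_in X : X \in S -> qrank M X = k%:R - 1.
(* As [k] is positive, [k.-1] does not truncate and casts to k - 1 in [rat]. *)
Proof. by move=> SX; rewrite /= /paving_rank SX -subn1 natrB. Qed.

Lemma paving_qrank_notin X : X \notin S -> qrank M X = (minn (\dim X) k)%:R.
Proof. by rewrite /= /paving_rank => /negPf->. Qed.

End CharpolyDiff.

Theorem theorem7p4 (F : finFieldType) (n k : nat)
  (n_ge2 : (2 <= n)%N) (k_gt0 : (0 < k)%N) (k_le : (k <= n - 1)%N)
  (S1 S2 : {set {vspace 'rV[F]_n}})
  (disj : [disjoint S1 & S2])
  (pav1 : paving_family k S1) (pav2 : paving_family k S2)
  (lam : rat) (lam01 : 0 < lam < 1) :
  let M1 := paving_qmatroid k_gt0 pav1 in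
  let M2 := paving_qmatroid k_gt0 pav2 in
  let M := convex_comb lam01 M1 M2 in
  let c : int := (-1) ^+ k * (#|F| ^ 'C(k, 2))%:R in
  charpoly M =
    charpoly M1
    + c *: ((#|S1|%:R : int) *: (tpow lam - tpow 1)
            + (#|S2|%:R : int) *: (tpow (1 - lam) - tpow 0))
  /\
  charpoly M =
    charpoly M2
    + c *: ((#|S1|%:R : int) *: (tpow lam - tpow 0)
            + (#|S2|%:R : int) *: (tpow (1 - lam) - tpow 1)).
Proof.
move=> M1 M2 M c.
have k_ltn : (k < n)%N by rewrite -(subnK (ltnW n_ge2)) addn1 ltnS.
have r1E := paving_qrank_full F n k _ k_gt0 k_ltn pav1.
have r2E := paving_qrank_full F n k _ k_gt0 k_ltn pav2.
have in1 X (SX : X \in S1) : qrank M1 X = k%:R - 1 /\ qrank M2 X = k%:R.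
  split; first exact: paving_qrank_in.
  (* [X] lies outside [S2], so [M2] gives it the generic rank min(k, k). *)
  rewrite /M2 paving_qrank_notin ?(disjointFr disj SX) //.
  by rewrite (pav1.1 _ SX) minnn.
have in2 X (SX : X \in S2) : qrank M1 X = k%:R /\ qrank M2 X = k%:R - 1.
  split; last exact: paving_qrank_in.
  rewrite /M1 paving_qrank_notin ?(disjointFl disj SX) //.
  by rewrite (pav2.1 _ SX) minnn.
have notin X : X \notin S1 -> X \notin S2 -> qrank M1 X = qrank M2 X.
  by move=> nS1X nS2X; rewrite /M1 /M2 !paving_qrank_notin.
have rM X : qrank M X = lam * qrank M1 X + (1 - lam) * qrank M2 X by [].
split; apply: charpoly_diff => // X;
  try by [move/pav1.1 | move/pav2.1].
(* For each formula, the goals are the exponents on [S1] in [M] and in [M1] or [M2], those on [S2],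
   then agreement elsewhere. *)
- by move=> /in1[e1 e2]; rewrite !rM r1E r2E e1 e2; ring.
- by move=> /in1[e1 _]; rewrite r1E e1; ring.
- by move=> /in2[e1 e2]; rewrite !rM r1E r2E e1 e2; ring.
- by move=> /in2[e1 _]; rewrite r1E e1; ring.
(* Where the two ranks agree, so does their combination, as the weights [lam] and [1 - lam] add up
   to 1. *)
- by move=> nS1X nS2X; rewrite !rM r1E r2E (notin X) //; ring.
- by move=> /in1[e1 e2]; rewrite !rM r1E r2E e1 e2; ring.
- by move=> /in1[_ e2]; rewrite r2E e2; ring.
- by move=> /in2[e1 e2]; rewrite !rM r1E r2E e1 e2; ring.
- by move=> /in2[_ e2]; rewrite r2E e2; ring.
- by move=> nS1X nS2X; rewrite !rM r1E r2E (notin X) //; ring.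
Qed.
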